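(* For every $\lambda\in\mathbb F$, the modules $T_{\lambda0}=(V,\rho_{\lambda0})$ and $T_{\lambda1}=(V,\rho_{\lambda1})$ are intermediate series modules of the 3-Lie algebra $A_\omega^\delta$.
   Context: $\mathbb F$ is a field of characteristic zero (so $\mathbb Z\subset\mathbb F$); all vector spaces and algebras are over $\mathbb F$. A 3-Lie algebra is a vector space $B$ with a linear map $[\,,\,,\,]:B\wedge B\wedge B\to B$ satisfying $[x_1,x_2,[x_3,x_4,x_5]]=[[x_1,x_2,x_3],x_4,x_5]+[x_3,[x_1,x_2,x_4],x_5]+[x_3,x_4,[x_1,x_2,x_5]]$ for all $x_i\in B$. A module of a 3-Lie algebra $B$ is a pair $(W,\rho)$, where $W$ is a vector space and $\rho:B\wedge B\to gl(W)$ is linear, such that for all $x_1,x_2,x_3,x_4\in B$: $[\rho(x_1,x_2),\rho(x_3,x_4)]=\rho([x_1,x_2,x_3],x_4)+\rho(x_3,[x_1,x_2,x_4])$ and $\rho([x_1,x_2,x_3],x_4)=\rho(x_1,x_2)\rho(x_3,x_4)+\rho(x_2,x_3)\rho(x_1,x_4)+\rho(x_3,x_1)\rho(x_2,x_4)$. A Cartan subalgebra of a 3-Lie algebra $B$ is a nilpotent subalgebra $H$ of $B$ such that, for all $y\in B$, $[y,H,B]\subseteq H$ implies $y\in H$. Given a $B$-module $(W,\rho)$, a Cartan subalgebra $H$ and $\kappa\in(H\wedge H)^*$, if $W_\kappa=\{w\in W\mid\rho(h_1,h_2)w=\kappa(h_1,h_2)w\ \ \forall h_1,h_2\in H\}\neq0$,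 then $\kappa$ is called a weight associated with $H$ and $W_\kappa$ its weight space. The module is a weight module if $W=\sum_{\kappa\in(H\wedge H)^*}W_\kappa$ for a Cartan subalgebra $H$; it is a Harish-Chandra module if it is a weight module and every weight space is finite-dimensional; a Harish-Chandra module is an intermediate series module if every weight space has dimension one. $A_\omega^\delta$ is the (simple) 3-Lie algebra with basis $\{L_r,M_r\mid r\in\mathbb Z\}$ and (skew-symmetric) bracket determined by $[L_r,L_s,M_t]=(s-r)L_{r+s-t}$, $[L_r,M_s,M_t]=(t-s)M_{s+t-r}$ for $r,s,t\in\mathbb Z$, all other brackets of basis elements (i.e. $[L_r,L_s,L_t]$ and $[M_r,M_s,M_t]$) being zero. $V=\sum_{\alpha\in\mathbb F}\mathbb F v_\alpha$ is the vector space with basis $\{v_\alpha\mid\alpha\in\mathbb F\}$. For $\lambda,\mu\in\mathbb F$, the linear map $\rho_{\lambda\mu}:A_\omega^\delta\wedge A_\omega^\delta\to gl(V)$ is defined, for $r,s\in\mathbb Z$ and $\alpha\in\mathbb F$, by $\rho_{\lambda\mu}(L_r,M_s)v_\alpha=(\lambda+\alpha+(s-r)\mu)v_{\alpha+s-r}$, $\rho_{\lambda\mu}(L_r,L_s)v_\alpha=0$, $\rho_{\lambda\mu}(M_r,M_s)v_\alpha=0$. The pair $T_{\lambda\mu}=(V,\rho_{\lambda\mu})$ is an $A_\omega^\delta$-module when $\mu\in\{0,1\}$. *)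

(* Defs.v *)
From HB Require Import structures.
From mathcomp Require Import all_boot all_order all_algebra.
From mathcomp Require Import ring.
From mathcomp Require Import sesquilinear classical_sets.
From mathcomp.multinomials Require Import freeg.

Set Implicit Arguments.
Unset Strict Implicit.
Unset Printing Implicit Defensive.

Import GRing.Theory.
Local Open Scope classical_set_scope.
Local Open Scope ring_scope.

(* A linear map B ^ B ^ B -> B is encoded as an alternating trilinear map;
   alternation in the adjacent pairs (1,2) and (2,3) implies it for (1,3). *)
HB.mixin Record Lmodule_isThreeLie (F : fieldType) B of GRing.Lmodule F B := {
  tbr : B -> B -> B -> B;
  tbr_linear1 : forall y z, linear (fun x => tbr x y z);
  tbr_linear2 : forall x z, linear (fun y => tbr x y z);
  tbr_linear3 : forall x y, linear (fun z => tbr x y z);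
  tbr_alt12 : forall x y, tbr x x y = 0;
  tbr_alt23 : forall x y, tbr x y y = 0;
  tbr_filippov : forall x1 x2 x3 x4 x5,
    tbr x1 x2 (tbr x3 x4 x5) =
      tbr (tbr x1 x2 x3) x4 x5 + tbr x3 (tbr x1 x2 x4) x5
      + tbr x3 x4 (tbr x1 x2 x5)
}.

#[short(type="threeLieType")]
HB.structure Definition ThreeLie (F : fieldType) :=
  { B of Lmodule_isThreeLie F B & GRing.Lmodule F B }.

Section LinearAlgebra.
Variables (F : fieldType) (W : lmodType F).
Implicit Type U S : set W.

Definition lspan S : set W :=
  [set w | exists2 s : seq (F * W),
     (forall p, p \in s -> S p.2) & w = \sum_(p <- s) p.1 *: p.2].

Definition is_subspace U : Prop :=
  U 0 /\ forall (a : F) (u v : W), U u -> U v -> U (a *: u + v).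

(* Meaningful for U a subspace. *)
Definition has_dim U (n : nat) : Prop :=
  exists b : 'I_n -> W,
    [/\ forall i, U (b i),
        forall c : 'I_n -> F, \sum_i c i *: b i = 0 -> forall i, c i = 0
      & forall w, U w -> exists c : 'I_n -> F, w = \sum_i c i *: b i].

Definition finite_dim U : Prop := exists n, has_dim U n.

End LinearAlgebra.

Section ThreeLieTheory.
Variables (F : fieldType) (B : threeLieType F).
Implicit Type H : set B.

Definition is_subalgebra H : Prop :=
  is_subspace H /\ forall x y z, H x -> H y -> H z -> H (tbr x y z).

Fixpoint lower_central H (n : nat) : set B :=
  if n is m.+1 then
    lspan [set u | exists x y z,
             [/\ lower_central H m x, H y, H z & u = tbr x y z]]
  else H.

Definition is_nilpotent H : Prop :=
  exists n, lower_central H n `<=` [set 0].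

Definition is_cartan H : Prop :=
  [/\ is_subalgebra H, is_nilpotent H
    & forall y, (forall h b, H h -> H (tbr y h b)) -> H y].

(* rho : B ^ B -> gl(W), encoded as an alternating bilinear map with values in
   the linear endomaps of W. *)
Record is_module (W : lmodType F) (rho : B -> B -> W -> W) : Prop := IsModule {
  rho_endo : forall x y, linear (rho x y);
  rho_bilinear : forall w, bilinear_for *:%R *:%R (fun x y => rho x y w);
  rho_alt : forall x w, rho x x w = 0;
  rho_comm : forall x1 x2 x3 x4 w,
    rho x1 x2 (rho x3 x4 w) - rho x3 x4 (rho x1 x2 w) =
      rho (tbr x1 x2 x3) x4 w + rho x3 (tbr x1 x2 x4) w;
  rho_bracket : forall x1 x2 x3 x4 w,
    rho (tbr x1 x2 x3) x4 w =
      rho x1 x2 (rho x3 x4 w) + rho x2 x3 (rho x1 x4 w)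
      + rho x3 x1 (rho x2 x4 w)
}.

(* kappa represents an element of (H ^ H)^*: only its values on H x H matter. *)
Definition is_alt_form H (kappa : B -> B -> F) : Prop :=
  [/\ forall a x x' y, H x -> H x' -> H y ->
        kappa (a *: x + x') y = a * kappa x y + kappa x' y,
      forall a x y y', H x -> H y -> H y' ->
        kappa x (a *: y + y') = a * kappa x y + kappa x y'
    & forall x, H x -> kappa x x = 0].

Section Weights.
Variables (W : lmodType F) (rho : B -> B -> W -> W).

Definition weight_space H (kappa : B -> B -> F) : set W :=
  [set w | forall h1 h2, H h1 -> H h2 -> rho h1 h2 w = kappa h1 h2 *: w].

Definition is_weight H (kappa : B -> B -> F) : Prop :=
  is_alt_form H kappa /\ exists2 w, weight_space H kappa w & w != 0.

Definition weight_module_wrt H : Prop :=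
  [/\ is_module rho, is_cartan H
    & lspan [set w | exists2 kappa, is_alt_form H kappa
                                  & weight_space H kappa w] = setT].

Definition harish_chandra_wrt H : Prop :=
  weight_module_wrt H /\
  forall kappa, is_weight H kappa -> finite_dim (weight_space H kappa).

Definition intermediate_series_wrt H : Prop :=
  harish_chandra_wrt H /\
  forall kappa, is_weight H kappa -> has_dim (weight_space H kappa) 1.

Definition weight_module : Prop := exists H, weight_module_wrt H.
Definition harish_chandra_module : Prop := exists H, harish_chandra_wrt H.
Definition intermediate_series_module : Prop :=
  exists H, intermediate_series_wrt H.

End Weights.
End ThreeLieTheory.

Section FreeModule.
Variables (F : fieldType) (K : choiceType) (M : lmodType F).
Implicit Types (f g : K -> M) (x y : {freeg K / F}).

Lemma fglift_linear f : linear (fglift f : {freeg K / F} -> M).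
Proof.
pose h := GRing.isZmodMorphism.Build _ _ _ (lift_is_additive f).
pose fA : {additive {freeg K / F} -> M} := HB.pack (fglift f) h.
move=> a x y; rewrite -[LHS]/(fA _) raddfD /=; congr (_ + _).
have fE (s : seq K) (c : K -> F) :
    fglift f (\sum_(z <- s) << c z *g z >>) = \sum_(z <- s) c z *: f z.
  rewrite -[LHS]/(fA _) raddf_sum; apply: eq_bigr => z _; exact: liftU.
rewrite -[in RHS](freeg_sumE x) !fE scaler_sumr.
by apply: eq_bigr => z _; rewrite scalerA.
Qed.

HB.instance Definition _ f :=
  GRing.isLinear.Build F {freeg K / F} M *:%R (fglift f) (fglift_linear f).

Lemma fgliftE f x : fglift f x = \sum_(k <- dom x) coeff k x *: f k.
Proof.
by rewrite -{1}[x]freeg_sumE linear_sum; apply: eq_bigr => k _; apply: liftU.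
Qed.

Lemma fgliftU1 f k : fglift f << k >> = f k.
Proof. by rewrite liftU scale1r. Qed.

Lemma freeg_linear_ind (k0 : K) (P : {freeg K / F} -> Prop) :
    (forall k, P << k >>) ->
    (forall a x y, P x -> P y -> P (a *: x + y)) ->
  forall x, P x.
Proof.
move=> PU PL.
have P0 : P 0.
  by rewrite -(addNr << k0 >>) -scaleN1r; apply: PL.
elim/freeg_ind_dom0 => // c k x _ _ Px.
suff -> : << c *g k >> = c *: << k >> :> {freeg K / F} by apply: PL.
by apply/eqP/freeg_eqP => j; rewrite coeffZ !coeffU mul1r.
Qed.

Lemma fglift_comb f g a x :
  fglift (fun k => a *: f k + g k) x = a *: fglift f x + fglift g x.
Proof.
rewrite !fgliftE scaler_sumr -big_split; apply: eq_bigr => k _ /=.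
by rewrite scalerDr !scalerA mulrC.
Qed.

Lemma eq_fglift f g x : f =1 g -> fglift f x = fglift g x.
Proof.
by move=> fg; rewrite !fgliftE; apply: eq_bigr => k _; rewrite fg.
Qed.

End FreeModule.

Section AOmega.
Variable F : fieldType.

(* Basis: inl r stands for L_r and inr r for M_r. *)
Definition Aomega : Type := {freeg (int + int)%type / F}.
HB.instance Definition _ := GRing.Lmodule.on Aomega.

Definition Lgen (r : int) : Aomega := << inl r >>.
Definition Mgen (r : int) : Aomega := << inr r >>.

(* Bracket of basis vectors; the cases other than LLM and LMM are the ones
   forced by skew-symmetry. *)
Definition omega_br0 (i j k : int + int) : Aomega :=
  match i, j, k with
  | inl r, inl s, inr t => (s - r)%:~R *: Lgen (r + s - t)
  | inl r, inr t, inl s => - (s - r)%:~R *: Lgen (r + s - t)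
  | inr t, inl r, inl s => (s - r)%:~R *: Lgen (r + s - t)
  | inl r, inr s, inr t => (t - s)%:~R *: Mgen (s + t - r)
  | inr s, inl r, inr t => - (t - s)%:~R *: Mgen (s + t - r)
  | inr s, inr t, inl r => (t - s)%:~R *: Mgen (s + t - r)
  | inl _, inl _, inl _ | inr _, inr _, inr _ => 0
  end.

Definition omega_br (x y z : Aomega) : Aomega :=
  fglift (fun i => fglift (fun j => fglift (omega_br0 i j) z) y) x.

Lemma omega_br_linear1 a x x' y z :
  omega_br (a *: x + x') y z = a *: omega_br x y z + omega_br x' y z.
Proof. exact: fglift_linear. Qed.

Lemma omega_br_linear2 a x y y' z :
  omega_br x (a *: y + y') z = a *: omega_br x y z + omega_br x y' z.
Proof.
by rewrite -fglift_comb; apply: eq_fglift => i; apply: fglift_linear.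
Qed.

Lemma omega_br_linear3 a x y z z' :
  omega_br x y (a *: z + z') = a *: omega_br x y z + omega_br x y z'.
Proof.
rewrite -fglift_comb; apply: eq_fglift => i.
by rewrite -fglift_comb; apply: eq_fglift => j; apply: fglift_linear.
Qed.

Let brL := (omega_br_linear1, omega_br_linear2, omega_br_linear3).

Lemma omega_brU i j k :
  omega_br << i >> << j >> << k >> = omega_br0 i j k.
Proof. by rewrite /omega_br !fgliftU1. Qed.

Lemma omega_br0l y z : omega_br 0 y z = 0.
Proof. exact: linear0. Qed.

Lemma omega_brZl a x y z : omega_br (a *: x) y z = a *: omega_br x y z.
Proof. by rewrite -[a *: x]addr0 brL omega_br0l addr0. Qed.

Lemma omega_br0m x z : omega_br x 0 z = 0.
Proof.
have /addIr : omega_br x 0 z + omega_br x 0 z = 0 + omega_br x 0 z; last by [].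
by rewrite add0r -{1}[omega_br x 0 z]scale1r -omega_br_linear2 scaler0 addr0.
Qed.

Lemma omega_brZm a x y z : omega_br x (a *: y) z = a *: omega_br x y z.
Proof. by rewrite -[a *: y]addr0 brL omega_br0m addr0. Qed.

Lemma omega_br0r x y : omega_br x y 0 = 0.
Proof.
have /addIr : omega_br x y 0 + omega_br x y 0 = 0 + omega_br x y 0; last by [].
by rewrite add0r -{1}[omega_br x y 0]scale1r -omega_br_linear3 scaler0 addr0.
Qed.

Lemma omega_brZr a x y z : omega_br x y (a *: z) = a *: omega_br x y z.
Proof. by rewrite -[a *: z]addr0 brL omega_br0r addr0. Qed.

Let brZ := (omega_br0l, omega_br0m, omega_br0r,
            omega_brZl, omega_brZm, omega_brZr).

Lemma omega_ind (P : Aomega -> Prop) :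
    (forall i, P << i >>) ->
    (forall a x y, P x -> P y -> P (a *: x + y)) ->
  forall x, P x.
Proof. exact: (freeg_linear_ind (inl 0)). Qed.

Lemma omega_br_skew12 x y z : omega_br x y z = - omega_br y x z.
Proof.
elim/omega_ind: x => [i|a x x' hx hx']; last first.
  by rewrite !brL hx hx' scalerN opprD.
elim/omega_ind: y => [j|a y y' hy hy']; last first.
  by rewrite !brL hy hy' scalerN opprD.
elim/omega_ind: z => [k|a z z' hz hz']; last first.
  by rewrite !brL hz hz' scalerN opprD.
rewrite !omega_brU; case: i j k => [r|r] [s|s] [t|t] /=;
  rewrite ?oppr0 -?scaleNr ?opprK // -?intrN ?opprB.
- by rewrite [s + r]addrC.
- by rewrite [s + r]addrC.
Qed.

Lemma omega_br_skew23 x y z : omega_br x y z = - omega_br x z y.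
Proof.
elim/omega_ind: x => [i|a x x' hx hx']; last first.
  by rewrite !brL hx hx' scalerN opprD.
elim/omega_ind: y => [j|a y y' hy hy']; last first.
  by rewrite !brL hy hy' scalerN opprD.
elim/omega_ind: z => [k|a z z' hz hz']; last first.
  by rewrite !brL hz hz' scalerN opprD.
rewrite !omega_brU; case: i j k => [r|r] [s|s] [t|t] /=;
  rewrite ?oppr0 -?scaleNr ?opprK // -?intrN ?opprB.
- by rewrite [t + s]addrC.
- by rewrite [t + s]addrC.
Qed.

Lemma omega_br_alt12 x y : omega_br x x y = 0.
Proof.
elim/omega_ind: x => [i|a x x' hx hx']; last first.
  rewrite !brL hx hx' [omega_br x' x y]omega_br_skew12.
  by rewrite scalerN !scaler0 add0r addr0 subrr.
elim/omega_ind: y => [j|a y y' hy hy']; last first.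
  by rewrite !brL hy hy' scaler0 addr0.
by rewrite omega_brU; case: i j => r [s|s] //=; rewrite subrr scale0r.
Qed.

Lemma omega_br_alt23 x y : omega_br x y y = 0.
Proof.
by rewrite omega_br_skew12 omega_br_skew23 omega_br_alt12 !oppr0.
Qed.

Lemma omega_filippov x1 x2 x3 x4 x5 :
  omega_br x1 x2 (omega_br x3 x4 x5) =
    omega_br (omega_br x1 x2 x3) x4 x5 + omega_br x3 (omega_br x1 x2 x4) x5
    + omega_br x3 x4 (omega_br x1 x2 x5).
Proof.
have comb (a : F) (u u' v v' w w' : Aomega) :
    a *: (u + v + w) + (u' + v' + w') =
    (a *: u + u') + (a *: v + v') + (a *: w + w').
  by rewrite !scalerDr addrACA; congr (_ + _); rewrite addrACA.
elim/omega_ind: x1 => [i1|a x x' hx hx']; last by rewrite !brL hx hx' comb.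
elim/omega_ind: x2 => [i2|a x x' hx hx']; last by rewrite !brL hx hx' comb.
elim/omega_ind: x3 => [i3|a x x' hx hx']; last by rewrite !brL hx hx' comb.
elim/omega_ind: x4 => [i4|a x x' hx hx']; last by rewrite !brL hx hx' comb.
elim/omega_ind: x5 => [i5|a x x' hx hx']; last by rewrite !brL hx hx' comb.
rewrite !omega_brU.
case: i1 i2 i3 i4 i5 => [p|p] [q|q] [r|r] [s|s] [t|t] /=;
  rewrite /Lgen /Mgen ?brZ ?omega_brU //= ?(scaler0, addr0, add0r) //;
  rewrite /Lgen /Mgen !scalerA.
all: match goal with
     | |- context [<< inl ?n >>] =>
       repeat match goal with |- context [<< inl ?m >>] =>
         tryif constr_eq m n then fail else
           (rewrite (_ : << inl m >> = << inl n >> :> Aomega); last first;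
              [by congr (<< inl _ >>); ring | ])
       end
     | |- context [<< inr ?n >>] =>
       repeat match goal with |- context [<< inr ?m >>] =>
         tryif constr_eq m n then fail else
           (rewrite (_ : << inr m >> = << inr n >> :> Aomega); last first;
              [by congr (<< inr _ >>); ring | ])
       end
     end.
all: rewrite -!scalerDl.
all: lazymatch goal with
     | |- 0 = ?c *: _ =>
       suff -> : c = 0; [by rewrite scale0r | by ring]
     | |- _ => by congr (_ *: _); ring
     end.
Qed.

HB.instance Definition _ := Lmodule_isThreeLie.Build F Aomega
  (fun y z a x x' => omega_br_linear1 a x x' y z)
  (fun x z a y y' => omega_br_linear2 a x y y' z)
  (fun x y a z z' => omega_br_linear3 a x y z z')
  omega_br_alt12 omega_br_alt23 omega_filippov.

Lemma Aomega_LLM r s t :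
  tbr (Lgen r) (Lgen s) (Mgen t) = (s - r)%:~R *: Lgen (r + s - t).
Proof. exact: omega_brU. Qed.

Lemma Aomega_LMM r s t :
  tbr (Lgen r) (Mgen s) (Mgen t) = (t - s)%:~R *: Mgen (s + t - r).
Proof. exact: omega_brU. Qed.

Lemma Aomega_LLL r s t : tbr (Lgen r) (Lgen s) (Lgen t) = 0.
Proof. exact: omega_brU. Qed.

Lemma Aomega_MMM r s t : tbr (Mgen r) (Mgen s) (Mgen t) = 0.
Proof. exact: omega_brU. Qed.

End AOmega.

Section IntermediateSeries.
Variables (F : fieldType) (lambda mu : F).

Definition Tspace : Type := {freeg F / F}.
HB.instance Definition _ := GRing.Lmodule.on Tspace.

Definition vgen (alpha : F) : Tspace := << alpha >>.

Definition T_rho0 (i j : int + int) (alpha : F) : Tspace :=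
  match i, j with
  | inl r, inr s =>
      (lambda + alpha + (s - r)%:~R * mu) *: vgen (alpha + (s - r)%:~R)
  | inr s, inl r =>
      - (lambda + alpha + (s - r)%:~R * mu) *: vgen (alpha + (s - r)%:~R)
  | inl _, inl _ | inr _, inr _ => 0
  end.

Definition T_rho (x y : Aomega F) (v : Tspace) : Tspace :=
  fglift (fun i => fglift (fun j => fglift (T_rho0 i j) v) y) x.

Lemma T_rhoLM r s alpha :
  T_rho (Lgen F r) (Mgen F s) (vgen alpha) =
  (lambda + alpha + (s - r)%:~R * mu) *: vgen (alpha + (s - r)%:~R).
Proof. by rewrite /T_rho !fgliftU1. Qed.

Lemma T_rhoLL r s alpha : T_rho (Lgen F r) (Lgen F s) (vgen alpha) = 0.
Proof. by rewrite /T_rho !fgliftU1. Qed.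

Lemma T_rhoMM r s alpha : T_rho (Mgen F r) (Mgen F s) (vgen alpha) = 0.
Proof. by rewrite /T_rho !fgliftU1. Qed.

End IntermediateSeries.

(* Main.v *)
Require Import Defs.
From HB Require Import structures.
From mathcomp Require Import all_boot all_order all_algebra.
From mathcomp Require Import ring.
From mathcomp Require Import sesquilinear classical_sets.
From mathcomp.multinomials Require Import freeg.
Import GRing.Theory.
Local Open Scope ring_scope.

(** Write D_n for the operator v_alpha |-> (lambda + alpha + n mu) v_(alpha + n)
    of T_(lambda, mu).  On basis vectors rho is then D_(s - r) on (L_r, M_s),
    its opposite on (M_s, L_r), and zero on (L_r, L_s) and (M_r, M_s).  When
    mu * mu = mu these operators multiply by a rule ([shift_op_comp]) whose
    scalar depends on n but not on m,
      D_m D_n v_alpha = (lambda + alpha + n) D_(m + n) v_alpha.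
    In each module axiom, all terms have the same total shift, so on v_alpha
    every term is a scalar times one and the same vector D_N v_alpha, and the
    axiom becomes a linear identity between the scalars.  The idempotents of F
    being 0 and 1, this covers exactly the two modules of the theorem.

    The Cartan subalgebra is the plane H spanned by L_0 and M_0.  An
    alternating bilinear map on H is determined by its value at (L_0, M_0)
    ([alt_on_plane]), so that only two operators matter.
    - The adjoint map [L_0, M_0, _] is diagonal in the basis of A_omega, with
      eigenvalue -r on L_r and s on M_s.  It kills H, hence the bracket of H
      is zero; and in characteristic 0 its eigenvalues off H are nonzero, so
      that [y, L_0, M_0] in H already forces y in H.
    - The operator rho(L_0, M_0) = D_0 is diagonal in the basis of V, with the
      pairwise distinct eigenvalues lambda + alpha.  A weight kappa is the
      scalar kappa(L_0, M_0), and its weight space is the line through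
      v_(kappa(L_0, M_0) - lambda); these lines span V. *)

Set Implicit Arguments.
Unset Strict Implicit.
Unset Printing Implicit Defensive.

(** * The module axioms *)

Section Module.
Variables (F : fieldType) (lambda mu : F).
Implicit Types (x y : Aomega F) (w : Tspace F).

Local Notation rho := (T_rho lambda mu).

Lemma T_rho_linear1 a x x' y w :
  rho (a *: x + x') y w = a *: rho x y w + rho x' y w.
Proof. exact: fglift_linear. Qed.

Lemma T_rho_linear2 a x y y' w :
  rho x (a *: y + y') w = a *: rho x y w + rho x y' w.
Proof.
by rewrite -fglift_comb; apply: eq_fglift => i; apply: fglift_linear.
Qed.

Lemma T_rho_linear3 a x y w w' :
  rho x y (a *: w + w') = a *: rho x y w + rho x y w'.
Proof.
rewrite -fglift_comb; apply: eq_fglift => i.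
by rewrite -fglift_comb; apply: eq_fglift => j; apply: fglift_linear.
Qed.

Lemma T_rho0l y w : rho 0 y w = 0.
Proof. exact: linear0. Qed.

Lemma T_rho0m x w : rho x 0 w = 0.
Proof.
have := T_rho_linear2 1 x 0 0 w.
by rewrite !scale1r addr0 -{1}[rho x 0 w]addr0 => /addrI.
Qed.

Lemma T_rho0r x y : rho x y 0 = 0.
Proof.
have := T_rho_linear3 1 x y 0 0.
by rewrite !scale1r addr0 -{1}[rho x y 0]addr0 => /addrI.
Qed.

Lemma T_rhoZl a x y w : rho (a *: x) y w = a *: rho x y w.
Proof. by rewrite -[a *: x]addr0 T_rho_linear1 T_rho0l addr0. Qed.

Lemma T_rhoZm a x y w : rho x (a *: y) w = a *: rho x y w.
Proof. by rewrite -[a *: y]addr0 T_rho_linear2 T_rho0m addr0. Qed.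

Lemma T_rhoZr a x y w : rho x y (a *: w) = a *: rho x y w.
Proof. by rewrite -[a *: w]addr0 T_rho_linear3 T_rho0r addr0. Qed.

Let rhoL := (T_rho_linear1, T_rho_linear2, T_rho_linear3).
Let rhoZ := (T_rho0l, T_rho0m, T_rho0r, T_rhoZl, T_rhoZm, T_rhoZr).
Let brL := (@omega_br_linear1 F, @omega_br_linear2 F, @omega_br_linear3 F).

(** The operator D_n through which rho acts, as a linear map of its own. *)
Definition shift_op (n : int) : Tspace F -> Tspace F :=
  fglift (fun alpha => (lambda + alpha + n%:~R * mu) *: vgen (alpha + n%:~R)).

Local Notation D := shift_op.

HB.instance Definition _ n :=
  GRing.isLinear.Build F (Tspace F) (Tspace F) *:%R (D n) (fglift_linear _).

Lemma shift_op0 n : D n 0 = 0.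
Proof. exact: linear0. Qed.

Lemma shift_opN n w : D n (- w) = - D n w.
Proof. exact: linearN. Qed.

Lemma shift_opE n alpha :
  D n (vgen alpha) = (lambda + alpha + n%:~R * mu) *: vgen (alpha + n%:~R).
Proof. exact: fgliftU1. Qed.

(** With x = lambda + alpha, the scalar on the left is
    (x + n mu) (x + n + m mu), which for mu * mu = mu factors as
    (x + n) (x + (m + n) mu); the second factor is the scalar of D_(m + n). *)
Lemma shift_op_comp (mu_idem : mu * mu = mu) m n alpha :
  D m (D n (vgen alpha)) = (lambda + alpha + n%:~R) *: D (m + n) (vgen alpha).
Proof.
rewrite shift_opE linearZ /= !shift_opE !scalerA.
have -> : alpha + n%:~R + m%:~R = alpha + (m + n)%:~R by ring.
by congr (_ *: _); ring: mu_idem.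
Qed.

Definition rho_gen (i j : int + int) (w : Tspace F) : Tspace F :=
  match i, j with
  | inl r, inr s => D (s - r) w
  | inr s, inl r => - D (s - r) w
  | inl _, inl _ | inr _, inr _ => 0
  end.

Lemma Tspace_ind (P : Tspace F -> Prop) :
    (forall alpha, P (vgen alpha)) ->
    (forall a w w', P w -> P w' -> P (a *: w + w')) ->
  forall w, P w.
Proof. exact: (freeg_linear_ind 0). Qed.

Lemma T_rho_genE i j w : rho << i >> << j >> w = rho_gen i j w.
Proof.
elim/Tspace_ind: w => [alpha|a w w' hw hw']; last first.
  rewrite rhoL hw hw'; case: i j {hw hw'} => [r|r] [s|s] /=;
    by rewrite ?scaler0 ?addr0 // linearP // opprD scalerN.
rewrite /T_rho !fgliftU1.
by case: i j => [r|r] [s|s] //=; rewrite shift_opE // scaleNr.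
Qed.

Lemma T_rho_skew x y w : rho x y w = - rho y x w.
Proof.
elim/omega_ind: x => [i|a x x' hx hx']; last first.
  by rewrite !rhoL hx hx' scalerN opprD.
elim/omega_ind: y => [j|a y y' hy hy']; last first.
  by rewrite !rhoL hy hy' scalerN opprD.
by rewrite !T_rho_genE; case: i j => [r|r] [s|s] /=; rewrite ?oppr0 ?opprK.
Qed.

Lemma T_rho_alt x w : rho x x w = 0.
Proof.
elim/omega_ind: x => [i|a x x' hx hx']; last first.
  rewrite !rhoL hx hx' [rho x' x w]T_rho_skew scaler0 addr0 add0r.
  by rewrite scalerN subrr.
by rewrite T_rho_genE; case: i.
Qed.

Hypothesis mu_idem : mu * mu = mu.

(* The tactic settles a module axiom on basis vectors, in each of the 16
   choices of the letters L and M.  Products of two operators are merged with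
   shift_op_comp, the indices of the remaining D _ are identified as integers,
   and what is left is an equality of scalars. *)
Ltac compare_shift_ops i1 i2 i3 i4 :=
  case: i1 i2 i3 i4 => [p|p] [q|q] [r|r] [s|s] /=;
  rewrite ?rhoZ ?T_rho_genE /= ?rhoZ ?T_rho_genE /= ?(shift_op0, shift_opN)
    ?(opprK, scaler0, oppr0, addr0, add0r) //;
  rewrite ?shift_op_comp // ?scalerN -?scaleNr ?scalerA;
  match goal with |- context [D ?n _] =>
    repeat match goal with |- context [D ?m _] =>
      tryif constr_eq m n then fail else
        (rewrite (_ : m = n); last by ring)
    end
  end;
  rewrite -?scaleNr -?scalerDl ?opprK;
  lazymatch goal with
  | |- 0 = ?c *: _ => suff -> : c = 0; [by rewrite scale0r | by ring]
  | |- _ => by congr (_ *: _); ring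
  end.

Lemma T_rho_bracket x1 x2 x3 x4 w :
  rho (tbr x1 x2 x3) x4 w =
    rho x1 x2 (rho x3 x4 w) + rho x2 x3 (rho x1 x4 w) + rho x3 x1 (rho x2 x4 w).
Proof.
rewrite -[tbr x1 x2 x3]/(omega_br x1 x2 x3).
have comb (a : F) (u u' v v' t t' : Tspace F) :
    a *: (u + v + t) + (u' + v' + t') =
    (a *: u + u') + (a *: v + v') + (a *: t + t').
  by rewrite !scalerDr addrACA; congr (_ + _); rewrite addrACA.
elim/omega_ind: x1 => [i1|a x x' hx hx'].
  2: by rewrite !(brL, rhoL) hx hx' comb.
elim/omega_ind: x2 => [i2|a x x' hx hx'].
  2: by rewrite !(brL, rhoL) hx hx' comb.
elim/omega_ind: x3 => [i3|a x x' hx hx'].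
  2: by rewrite !(brL, rhoL) hx hx' comb.
elim/omega_ind: x4 => [i4|a x x' hx hx'].
  2: by rewrite !(brL, rhoL) hx hx' comb.
elim/Tspace_ind: w => [alpha|a t t' ht ht'].
  2: by rewrite !rhoL ht ht' comb.
rewrite omega_brU !T_rho_genE.
by compare_shift_ops i1 i2 i3 i4.
Qed.

Lemma T_rho_comm x1 x2 x3 x4 w :
  rho x1 x2 (rho x3 x4 w) - rho x3 x4 (rho x1 x2 w) =
    rho (tbr x1 x2 x3) x4 w + rho x3 (tbr x1 x2 x4) w.
Proof.
rewrite -[tbr x1 x2 x3]/(omega_br x1 x2 x3) -[tbr x1 x2 x4]/(omega_br x1 x2 x4).
have combB (a : F) (u u' v v' : Tspace F) :
    a *: (u - v) + (u' - v') = (a *: u + u') - (a *: v + v').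
  by rewrite scalerBr addrACA opprD.
have combD (a : F) (u u' v v' : Tspace F) :
    a *: (u + v) + (u' + v') = (a *: u + u') + (a *: v + v').
  by rewrite scalerDr addrACA.
elim/omega_ind: x1 => [i1|a x x' hx hx'].
  2: by rewrite !(brL, rhoL) -combB hx hx' combD.
elim/omega_ind: x2 => [i2|a x x' hx hx'].
  2: by rewrite !(brL, rhoL) -combB hx hx' combD.
elim/omega_ind: x3 => [i3|a x x' hx hx'].
  2: by rewrite !(brL, rhoL) -combB hx hx' combD.
elim/omega_ind: x4 => [i4|a x x' hx hx'].
  2: by rewrite !(brL, rhoL) -combB hx hx' combD.
elim/Tspace_ind: w => [alpha|a t t' ht ht']; last first.
  by rewrite !rhoL -combB ht ht' combD.
rewrite !omega_brU !T_rho_genE.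
by compare_shift_ops i1 i2 i3 i4.
Qed.

Lemma T_rho_is_module : is_module rho.
Proof.
split; [ | | exact: T_rho_alt | exact: T_rho_comm | exact: T_rho_bracket].
- by move=> x y a w w'; apply: T_rho_linear3.
- move=> w; split=> [y|x] a u u'; [exact: T_rho_linear1 | exact: T_rho_linear2].
Qed.

End Module.

(** * The Cartan plane *)

Section CartanPlane.
Variable F : fieldType.
Implicit Types (x y z : Aomega F).

Local Notation L0 := (Lgen F 0).
Local Notation M0 := (Mgen F 0).

Definition cartan_plane : set (Aomega F) :=
  [set x | exists a b : F, x = a *: L0 + b *: M0].

Lemma coeff_plane i a b :
  coeff i (a *: L0 + b *: M0 : Aomega F) =
  a * (inl 0 == i)%:R + b * (inr 0 == i)%:R.
Proof. by rewrite coeffD !coeffZ !coeffU !mul1r. Qed.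

(** The form in which membership is used: operators that are diagonal in the
    basis are compared with H one coefficient at a time. *)
Lemma cartan_planeP x :
  cartan_plane x <-> forall i, i != inl 0 -> i != inr 0 -> coeff i x = 0.
Proof.
split=> [[a [b ->]] i|x0].
  rewrite coeff_plane ![i == _]eq_sym => /negPf-> /negPf->.
  by rewrite !mulr0 addr0.
exists (coeff (inl 0) x), (coeff (inr 0) x); apply/eqP/freeg_eqP => i.
rewrite coeff_plane.
have [->|i0] := eqVneq i (inl 0); first by rewrite mulr1 mulr0 addr0.
have [->|i0'] := eqVneq i (inr 0); first by rewrite mulr1 mulr0 add0r.
by rewrite x0 // !mulr0 addr0.
Qed.

Lemma cartan_plane_subspace : is_subspace cartan_plane.
Proof.
split=> [|a u v /cartan_planeP u0 /cartan_planeP v0];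
  apply/cartan_planeP => i iL iM.
  by rewrite coeff0.
by rewrite coeffD coeffZ u0 // v0 // mulr0 addr0.
Qed.

Lemma cartan_plane_Lgen : cartan_plane L0.
Proof. by exists 1, 0; rewrite scale1r scale0r addr0. Qed.

Lemma cartan_plane_Mgen : cartan_plane M0.
Proof. by exists 0, 1; rewrite scale1r scale0r add0r. Qed.

(** The scalar c such that x ^ y = c (L_0 ^ M_0) for x and y in H, that is, the
    generator of the one-dimensional space of alternating forms on H. *)
Definition wedge_coord x y : F :=
  coeff (inl 0) x * coeff (inr 0) y - coeff (inr 0) x * coeff (inl 0) y.

Lemma wedge_coord_Lgen_Mgen : wedge_coord L0 M0 = 1.
Proof. by rewrite /wedge_coord !coeffU /= !(mulr0, mul1r, subr0). Qed.

Lemma wedge_coord_alt_form : is_alt_form cartan_plane wedge_coord.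
Proof.
by split=> [a x x' y _ _ _|a x y y' _ _ _|x _];
  rewrite /wedge_coord ?coeffD ?coeffZ; ring.
Qed.

(** The exterior square of a plane is a line.  The hypotheses are confined to
    H so that the lemma applies to a form kappa known only there, as well as to
    the bracket and to rho; hence the values in an arbitrary space U. *)
Lemma alt_on_plane (U : lmodType F) (f : Aomega F -> Aomega F -> U) :
    (forall a x x' y, cartan_plane x -> cartan_plane x' -> cartan_plane y ->
       f (a *: x + x') y = a *: f x y + f x' y) ->
    (forall a x y y', cartan_plane x -> cartan_plane y -> cartan_plane y' ->
       f x (a *: y + y') = a *: f x y + f x y') ->
    (forall x, cartan_plane x -> f x x = 0) ->
  forall x y, cartan_plane x -> cartan_plane y ->
    f x y = wedge_coord x y *: f L0 M0.
Proof.
move=> fl fr falt.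
have HL := cartan_plane_Lgen; have HM := cartan_plane_Mgen.
have [H0 HD] := cartan_plane_subspace.
have HZ a u : cartan_plane u -> cartan_plane (a *: u).
  by move=> Hu; rewrite -[a *: u]addr0; apply: HD.
have flZ a x y : cartan_plane x -> cartan_plane y -> f (a *: x) y = a *: f x y.
  move=> Hx Hy; have f0 : f 0 y = 0.
    have := fl (-1) y y y Hy Hy Hy.
    by rewrite scaleN1r addNr falt // scaler0 addr0.
  by rewrite -[a *: x]addr0 fl // f0 addr0.
have frZ a x y : cartan_plane x -> cartan_plane y -> f x (a *: y) = a *: f x y.
  move=> Hx Hy; have f0 : f x 0 = 0.
    have := fr (-1) x x x Hx Hx Hx.
    by rewrite scaleN1r addNr falt // scaler0 addr0.
  by rewrite -[a *: y]addr0 fr // f0 addr0.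
have skew : f M0 L0 = - f L0 M0.
  have := falt (1 *: L0 + M0) (HD _ _ _ HL HM).
  rewrite fl ?fr //; [|exact: HD]; rewrite !falt // !scale1r add0r addr0.
  by move/eqP; rewrite addrC addr_eq0 => /eqP.
move=> x y [a [b ->]] [c [d ->]].
rewrite fl ?fr ?flZ ?frZ ?falt ?skew //;
  try by [apply: HZ | apply: HD => //; apply: HZ].
rewrite !scaler0 add0r addr0 !scalerN !scalerA -scalerBl.
rewrite /wedge_coord !coeff_plane /=.
by congr (_ *: _); ring.
Qed.

Lemma alt_form_plane kappa x y :
    is_alt_form cartan_plane kappa -> cartan_plane x -> cartan_plane y ->
  kappa x y = wedge_coord x y * kappa L0 M0.
Proof. by case=> kl kr kalt; apply: (@alt_on_plane F^o kappa). Qed.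

Lemma T_rho_plane lambda mu x y w : cartan_plane x -> cartan_plane y ->
  T_rho lambda mu x y w = wedge_coord x y *: T_rho lambda mu L0 M0 w.
Proof.
apply: (alt_on_plane (f := fun x y => T_rho lambda mu x y w)) => *.
- exact: T_rho_linear1.
- exact: T_rho_linear2.
- exact: T_rho_alt.
Qed.

(** The eigenvalue of [L_0, M_0, _] on the basis vector of index i. *)
Definition ad_weight (i : int + int) : F :=
  match i with inl r => - r%:~R | inr s => s%:~R end.

Lemma coeff_ad i x : coeff i (omega_br L0 M0 x) = ad_weight i * coeff i x.
Proof.
elim/omega_ind: x => [j|a x x' hx hx'].
  rewrite omega_brU; case: j => r /=; rewrite coeffZ !coeffU !mul1r.
    by rewrite add0r !subr0; case: eqP => [<-|]; rewrite ?mulr0.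
  by rewrite add0r !subr0; case: eqP => [<-|]; rewrite ?mulr0.
by rewrite omega_br_linear3 !coeffD !coeffZ hx hx'; ring.
Qed.

(** On H x H the bracket with z is a multiple of [L_0, M_0, z], and
    [L_0, M_0, _] has eigenvalue 0 on L_0 and on M_0. *)
Lemma tbr_plane x y z :
  cartan_plane x -> cartan_plane y -> cartan_plane z -> tbr x y z = 0.
Proof.
move=> Hx Hy /cartan_planeP z0.
rewrite (alt_on_plane (f := fun x y => tbr x y z)) //.
- have -> : tbr L0 M0 z = 0; last exact: scaler0.
  apply/eqP/freeg_eqP => i; rewrite coeff_ad coeff0.
  have [->|iL] := eqVneq i (inl 0); first by rewrite /= oppr0 mul0r.
  have [->|iM] := eqVneq i (inr 0); first by rewrite mul0r.
  by rewrite z0 ?mulr0.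
- by move=> a u u' v _ _ _; apply: tbr_linear1.
- by move=> a u v v' _ _ _; apply: tbr_linear2.
- by move=> u _; apply: tbr_alt12.
Qed.

Lemma intr_eq0_pchar0 (charF0 : [pchar F] =i pred0) (n : int) :
  (n%:~R == 0 :> F) = (n == 0).
Proof.
move/pcharf0P: charF0 => natF0; case: n => n; first exact: natF0.
by rewrite NegzE mulrNz !oppr_eq0 natF0.
Qed.

(** Nilpotency holds at the first step, by [tbr_plane].  The self-normalizing
    condition is tested only on h = L_0 and b = M_0, where characteristic 0
    makes the eigenvalues of [L_0, M_0, _] off H invertible. *)
Lemma cartan_plane_cartan (charF0 : [pchar F] =i pred0) :
  is_cartan cartan_plane.
Proof.
split.
- split=> [|x y z Hx Hy Hz]; first exact: cartan_plane_subspace.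
  by rewrite tbr_plane //; case: cartan_plane_subspace.
- exists 1%N => _ [s Hs ->] /=; apply: big1_seq => p /andP[_ /Hs].
  by move=> [x [y [z [Hx Hy Hz ->]]]]; rewrite tbr_plane ?scaler0.
- move=> y /(_ L0 M0 cartan_plane_Lgen) /cartan_planeP ad_y.
  apply/cartan_planeP => i iL iM; have := ad_y i iL iM.
  rewrite -[tbr y L0 M0]/(omega_br y L0 M0) omega_br_skew12 omega_br_skew23.
  rewrite opprK coeff_ad => /eqP; rewrite mulf_eq0 => /orP[|/eqP//].
  case: i iL iM {ad_y} => r iL iM;
    rewrite /= ?oppr_eq0 intr_eq0_pchar0 // => /eqP r0.
    by rewrite r0 eqxx in iL.
  by rewrite r0 eqxx in iM.
Qed.

(** * Weight spaces *)

Variables lambda mu : F.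

Lemma coeff_T_rho alpha (w : Tspace F) :
  coeff alpha (T_rho lambda mu L0 M0 w) = (lambda + alpha) * coeff alpha w.
Proof.
elim/Tspace_ind: w => [beta|a w w' hw hw'].
  rewrite T_rhoLM subr0 mul0r !addr0 coeffZ !coeffU mul1r.
  by case: eqP => [->|]; rewrite ?mulr0.
by rewrite T_rho_linear3 !coeffD !coeffZ hw hw'; ring.
Qed.

(** By [alt_on_plane], w has weight kappa as soon as rho(L_0, M_0) acts on it
    by kappa(L_0, M_0); comparing coefficients, (lambda + beta) w_beta =
    kappa(L_0, M_0) w_beta leaves only beta = alpha. *)
Lemma weight_spaceP kappa (w : Tspace F) : is_alt_form cartan_plane kappa ->
  let alpha := kappa L0 M0 - lambda in
  weight_space (T_rho lambda mu) cartan_plane kappa w <->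
  w = coeff alpha w *: vgen alpha.
Proof.
move=> kappa_alt alpha.
have rhoE (b : F) :
    T_rho lambda mu L0 M0 (b *: vgen alpha) = kappa L0 M0 *: (b *: vgen alpha).
  rewrite T_rhoZr T_rhoLM subr0 mul0r !addr0 scalerA mulrC -scalerA.
  by rewrite [lambda + _]addrC subrK.
split=> [wP|-> h1 h2 Hh1 Hh2]; last first.
  by rewrite (alt_form_plane kappa_alt Hh1 Hh2) T_rho_plane // rhoE !scalerA.
apply/eqP/freeg_eqP => beta; rewrite coeffZ coeffU mul1r.
have [->|ab] := eqVneq alpha beta; first by rewrite mulr1.
have := congr1 (coeff beta) (wP _ _ cartan_plane_Lgen cartan_plane_Mgen).
rewrite coeff_T_rho coeffZ mulr0 => /eqP; rewrite -subr_eq0 -mulrBl mulf_eq0.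
case/orP=> /eqP // k0; case/eqP: ab; apply/eqP.
by rewrite -subr_eq0 -oppr_eq0 -k0 /alpha; apply/eqP; ring.
Qed.

Lemma weight_space_dim1 kappa : is_alt_form cartan_plane kappa ->
  has_dim (weight_space (T_rho lambda mu) cartan_plane kappa) 1.
Proof.
move=> kappa_alt; pose alpha := kappa L0 M0 - lambda.
exists (fun _ => vgen alpha); split=> [_|c|w /(weight_spaceP _ kappa_alt) wE].
- by apply/weight_spaceP; rewrite // coeffU eqxx mulr1 scale1r.
- rewrite big_ord1 => /(congr1 (coeff alpha)).
  rewrite coeffZ coeffU coeff0 eqxx !mulr1 => c0 i; by rewrite ord1.
- by exists (fun _ => coeff alpha w); rewrite big_ord1.
Qed.

(** The vector v_alpha has the weight whose value at (L_0, M_0) is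
    lambda + alpha, that is, the form (lambda + alpha) * wedge_coord. *)
Lemma weight_spaces_span :
  lspan [set w | exists2 kappa, is_alt_form cartan_plane kappa
                   & weight_space (T_rho lambda mu) cartan_plane kappa w]
  = setT.
Proof.
apply/seteqP; split=> // w _.
exists [seq (coeff alpha w, vgen alpha) | alpha <- dom w]; last first.
  rewrite big_map -[LHS](freeg_sumE w); apply: eq_bigr => alpha _ /=.
  by apply/eqP/freeg_eqP => beta; rewrite coeffZ !coeffU mul1r.
move=> _ /mapP[alpha _ ->] /=; set c := lambda + alpha.
have [al ar aalt] := wedge_coord_alt_form.
have kappa_alt : is_alt_form cartan_plane (fun x y => wedge_coord x y * c).
  split=> [a x x' y Hx Hx' Hy|a x y y' Hx Hy Hy'|x Hx].
  - by rewrite al // mulrDl mulrA.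
  - by rewrite ar // mulrDl mulrA.
  - by rewrite aalt // mul0r.
exists (fun x y => wedge_coord x y * c) => //; apply/weight_spaceP => //.
by rewrite wedge_coord_Lgen_Mgen mul1r /c addrC addKr coeffU eqxx mulr1 scale1r.
Qed.

Lemma T_rho_intermediate_series (charF0 : [pchar F] =i pred0) :
  mu * mu = mu -> intermediate_series_module (T_rho lambda mu).
Proof.
move=> mu_idem; exists cartan_plane; split=> [|kappa [kappa_alt _]].
  split=> [|kappa [kappa_alt _]]; last first.
    by exists 1%N; apply: weight_space_dim1.
  split; [exact: T_rho_is_module | exact: cartan_plane_cartan |].
  exact: weight_spaces_span.
exact: weight_space_dim1.
Qed.

End CartanPlane.

Theorem theorem3p2 (F : fieldType) (charF0 : [pchar F] =i pred0) (lambda : F) :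
  @intermediate_series_module F (Aomega F) (Tspace F) (T_rho lambda 0) /\
  @intermediate_series_module F (Aomega F) (Tspace F) (T_rho lambda 1).
Proof.
by split; apply: T_rho_intermediate_series => //; rewrite ?mulr0 ?mulr1.
Qed.
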